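(* Let $n\ge 8$ be even, $k=n/2$, and let $\boldsymbol{\mathsf{C}}$ be a code chosen uniformly at random from the set of all binary self-dual codes of length $n$. Then the expected theta series ratio $\mathbb{E}\bigl[\Delta_{\Lambda_{\mathrm A}(\boldsymbol{\mathsf{C}})}(\tau)\bigr]$, $\tau>0$, of the Construction A lattice obtained from $\boldsymbol{\mathsf{C}}$ achieves its global minimum at $\tau=1$, and for all $\tau>0$, $$\frac{(\sqrt2-1)^k+(\sqrt2+1)^k}{2^{k/2}\,(1+2^{k-1})}\,\vartheta_3^n(i\tau)\;\le\;\mathbb{E}\bigl[\Theta_{\Lambda_{\mathrm A}(\boldsymbol{\mathsf{C}})}(i\tau)\bigr]\;\le\;\vartheta_3^n(i\tau).$$
   Context: A binary linear code $\mathcal{C}\subseteq\mathbb{F}_2^n$ is self-dual if $\mathcal{C}=\mathcal{C}^\perp$ with respect to the standard inner product modulo $2$ (so its dimension is $k=n/2$). Its weight enumerator is $W_{\mathcal{C}}(x,y)=\sum_{c\in\mathcal{C}}x^{n-w_{\mathrm H}(c)}y^{w_{\mathrm H}(c)}$, with $w_{\mathrm H}$ the Hamming weight. The Construction A lattice is $\Lambda_{\mathrm A}(\mathcal{C})=\frac1{\sqrt2}(\mathcal{C}+2\mathbb{Z}^n)$, codewords being viewed as $0/1$ integer vectors; it has volume $1$ when $\mathcal{C}$ is self-dual. For a lattice $\Lambda$ and $\tau>0$, $\Theta_\Lambda(i\tau)=\sum_{\lambda\in\Lambda}e^{-\pi\tau\|\lambda\|^2}$; the theta series ratio of a volume-one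 lattice $\Lambda\subset\mathbb{R}^n$ is $\Delta_\Lambda(\tau)=\Theta_\Lambda(i\tau)/\Theta_{\mathbb{Z}^n}(i\tau)$, and $\Theta_{\mathbb{Z}^n}(i\tau)=\vartheta_3^n(i\tau)$ with $\vartheta_3(i\tau)=\sum_{v\in\mathbb{Z}}e^{-\pi\tau v^2}$. Put also $\vartheta_4(i\tau)=\sum_{v\in\mathbb{Z}}(-1)^ve^{-\pi\tau v^2}$ and $t(\tau)=\vartheta_4^2(i\tau)/\vartheta_3^2(i\tau)$. Known facts (from the literature): the expected weight enumerator of the random self-dual code is $$\overline{W}(x,y)=\mathbb{E}[W_{\boldsymbol{\mathsf{C}}}(x,y)]=x^n+y^n+\frac{1}{2^{k-1}+1}\sum_{w'=1}^{k-1}\binom{n}{2w'}x^{n-2w'}y^{2w'},$$ and for a self-dual code $\Delta_{\Lambda_{\mathrm A}(\mathcal{C})}(\tau)=2^{-k}W_{\mathcal{C}}\bigl(\sqrt{1+t(\tau)},\sqrt{1-t(\tau)}\bigr)$, so that the expected theta series ratio is $$\mathbb{E}\bigl[\Delta_{\Lambda_{\mathrm A}(\boldsymbol{\mathsf{C}})}(\tau)\bigr]=\frac{\overline{W}\bigl(\sqrt{1+t(\tau)},\sqrt{1-t(\tau)}\bigr)}{2^k}.$$ *)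

(* Defs.v *)
From HB Require Import structures.
From mathcomp Require Import all_boot all_order all_algebra.
From mathcomp Require Import all_classical all_reals all_analysis.

Set Implicit Arguments.
Unset Strict Implicit.
Unset Printing Implicit Defensive.

Import Order.TTheory GRing.Theory Num.Theory.

Local Open Scope classical_set_scope.
Local Open Scope ring_scope.

Definition linear_code n (C : {set 'rV['F_2]_n}) : bool :=
  (0 \in C) &&
  [forall a : 'F_2, forall u in C, forall v in C, a *: u + v \in C].

Definition dual_code n (C : {set 'rV['F_2]_n}) : {set 'rV['F_2]_n} :=
  finset (fun u : 'rV['F_2]_n => [forall v in C, \sum_i u 0 i * v 0 i == 0]).

Definition self_dual_codes n : {set {set 'rV['F_2]_n}} :=
  finset (fun C : {set 'rV['F_2]_n} => linear_code C && (C == dual_code C)).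

(* The elements of 'F_2 are the ordinals 0 and 1, so this views a codeword as
   a vector of integers in {0, 1}. *)
Definition lift01 n (c : 'rV['F_2]_n) : 'rV[int]_n :=
  map_mx (fun a : 'F_2 => (a : nat)%:Z) c.

Definition construction_A (R : realType) n (C : {set 'rV['F_2]_n}) :
    set 'rV[R]_n :=
  [set l | exists2 c : 'rV['F_2]_n, c \in C &
     exists z : 'rV[int]_n,
       l = (Num.sqrt 2)^-1 *: map_mx intr (lift01 c + 2 *: z)].
Arguments construction_A R {n} C _.

Definition integer_lattice (R : realType) n : set 'rV[R]_n :=
  range (fun z : 'rV[int]_n => map_mx intr z).
Arguments integer_lattice R n _ : clear implicits.

(* The library norm `|l| on row vectors is the sup norm, hence this explicit
   squared Euclidean norm. *)
Definition sqnorm (R : realType) n (l : 'rV[R]_n) : R := \sum_i l 0 i ^+ 2.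

(* Theta series at the point i * tau of the imaginary axis.  All terms are
   positive, so the sum over L is an unordered sum in [0, +oo]; for a lattice
   and tau > 0 it is finite and [fine] reads it as a real number. *)
Definition theta_series (R : realType) n (L : set 'rV[R]_n) (tau : R) : R :=
  fine (\esum_(l in L) (expR (- (pi * tau * sqnorm l)))%:E).

Definition theta3 (R : realType) (tau : R) : R :=
  fine (\esum_(v in [set: int]) (expR (- (pi * tau * v%:~R ^+ 2)))%:E).

Definition theta_ratio (R : realType) n (L : set 'rV[R]_n) (tau : R) : R :=
  theta_series L tau / theta_series (integer_lattice R n) tau.

(* X is a (measurable) random element of the finite type F whose law is the
   uniform distribution on A. *)
Definition uniformly_distributed (R : realType) (d : measure_display)
    (T : measurableType d) (P : probability T R) (F : finType)
    (X : T -> F) (A : {set F}) : Prop :=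
  (forall x : F, measurable (X @^-1` [set x])) /\
  (forall x : F, P (X @^-1` [set x]) = ((x \in A)%:R / #|A|%:R)%:E).

(* Main.v *)
Require Import Defs.
From HB Require Import structures.
From mathcomp Require Import all_boot all_order all_algebra.
From mathcomp Require Import all_classical all_reals all_analysis.
From mathcomp Require Import measurable_realfun zify ring lra.

(** The theorem reduces to the convexity of an explicit function of theta
    constants, plus one special value of these constants.

    Averaging over self-dual codes.  A transvection [u |-> u + (u . a) a] with
    [a . a = 0] preserves the inner product, hence permutes the self-dual codes.
    Composing at most two of them carries any even vector other than 0 and the
    all-one vector to any other such vector, so all these vectors lie in the
    same number of self-dual codes ([codes_through_eq]).  Since a self-dual code
    has [2 ^ k] elements, double counting determines that number and yields the
    mean of any additive function of the code ([average_self_dual]).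

    Theta constants.  The theta series of the Construction A lattice is a sum
    over the code of products of [x = theta_3 (2 i tau)] and
    [y = theta_2 (2 i tau)].  Rotating the square lattice by 45 degrees gives
    the duplication formulas [p = x ^ 2 + y ^ 2], [e = 2 x y] for
    [p = theta_3 ^ 2] and [e = theta_2 ^ 2] at [i tau] ([theta_mul]), and one
    puts [d = x ^ 2 - y ^ 2], which is [theta_4 ^ 2].  Then
    [p ^ 2 = d ^ 2 + e ^ 2], and the mean theta series is
    [(f d + f e) / (2 (1 + 2 ^ (k - 1)))] where
    [f z = (p + z) ^ k + (p - z) ^ k] ([average_theta_series]).

    Convexity.  [f] is a polynomial with nonnegative coefficients in [z ^ 2], so
    under the constraint [d ^ 2 + e ^ 2 = p ^ 2] the sum [f d + f e] is least
    when [d ^ 2 = e ^ 2] and greatest when one of the two vanishes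
    ([sympow_ge_diag], [sympow_le_ends]).  These extreme values are the two
    bounds of the theorem.

    The minimum at [tau = 1].  It remains to see that [d = e] there
    ([theta_self_dual_point]), which is a case of the modular transformation
    of theta and is obtained here from the arithmetic-geometric mean.  Doubling
    [tau] makes [(p, d)] an AGM iteration, halving [tau] makes
    [tau (p, e)] one.  Both start at [tau = 1] from the same [p], and both tend
    to 1: comparison with the Gaussian integral shows that
    [sqrt tau * theta_3 (i tau)] is within [sqrt tau] of 1
    ([theta0_bounds]).  The AGM is strictly increasing in its second argument,
    hence [d = e] ([agm_inj]). *)

Set Implicit Arguments.
Unset Strict Implicit.
Unset Printing Implicit Defensive.

Import Order.TTheory GRing.Theory Num.Theory.

Local Open Scope ring_scope.

(** * Self-dual codes through a given vector *)

Section BinaryVectors.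
Variable n : nat.
Implicit Types (a b c u v w : 'rV['F_2]_n) (C : {set 'rV['F_2]_n}).

Definition dotv u v : 'F_2 := \sum_i u 0 i * v 0 i.

Lemma F2_cases (x : 'F_2) : x = 0 \/ x = 1.
Proof. by case: x => -[|[|//]] lt2; [left|right]; apply/val_inj. Qed.

Lemma F2_addrr (x : 'F_2) : x + x = 0.
Proof. by case: (F2_cases x) => ->; apply/val_inj. Qed.

Lemma F2_neq0 (x : 'F_2) : x != 0 -> x = 1.
Proof. by case: (F2_cases x) => -> //; rewrite eqxx. Qed.

Lemma dotvC u v : dotv u v = dotv v u.
Proof. by apply: eq_bigr => i _; rewrite mulrC. Qed.

Lemma dotvDl u v w : dotv (u + v) w = dotv u w + dotv v w.
Proof. by rewrite -big_split; apply: eq_bigr => i _; rewrite mxE mulrDl. Qed.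

Lemma dotvDr u v w : dotv u (v + w) = dotv u v + dotv u w.
Proof. by rewrite dotvC dotvDl ![dotv u _]dotvC. Qed.

Lemma dotvZl x u v : dotv (x *: u) v = x * dotv u v.
Proof. by rewrite mulr_sumr; apply: eq_bigr => i _; rewrite mxE mulrA. Qed.

Lemma dotvZr x u v : dotv u (x *: v) = x * dotv u v.
Proof. by rewrite dotvC dotvZl dotvC. Qed.

Lemma dotv0 u : dotv u 0 = 0.
Proof. by apply: big1 => i _; rewrite mxE mulr0. Qed.

Lemma dotv_delta u i : dotv u (delta_mx 0 i) = u 0 i.
Proof.
rewrite /dotv (bigD1 i) //= big1 ?addr0 => [|j ji]; rewrite mxE eqxx /=.
  by rewrite eqxx mulr1.
by rewrite (negPf ji) mulr0.
Qed.

Lemma dotv_diag u : dotv u u = \sum_i u 0 i.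
Proof.
apply: eq_bigr => i _.
by case: (F2_cases (u 0 i)) => ->; rewrite ?mulr0 ?mulr1.
Qed.

Lemma addvv u : u + u = 0.
Proof. by apply/rowP => i; rewrite !mxE F2_addrr. Qed.

(** When [a . a = 0] this is an orthogonal transformation, and an involution. *)
Definition transvection a u := u + dotv u a *: a.

(** Self-adjointness is what carries duals to duals: [T u] is orthogonal to [C]
    exactly when [u] is orthogonal to [T C]. *)
Lemma transvection_dot a u v :
  dotv (transvection a u) v = dotv u (transvection a v).
Proof.
by rewrite dotvDl dotvDr dotvZl dotvZr [dotv a v]dotvC mulrC.
Qed.

Lemma transvectionK a : dotv a a = 0 -> involutive (transvection a).
Proof.
move=> aa u; rewrite {1}/transvection {2}/transvection dotvDl dotvZl aa mulr0.
by rewrite addr0 /transvection -addrA addvv addr0.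
Qed.

Lemma transvection_linear a x u v :
  transvection a (x *: u + v) = x *: transvection a u + transvection a v.
Proof.
by rewrite /transvection dotvDl dotvZl scalerDl scalerDr scalerA addrACA.
Qed.

Lemma self_dual_memE C u : C \in self_dual_codes n ->
  (u \in C) = [forall v in C, dotv u v == 0].
Proof.
by rewrite inE => /andP[_ /eqP CE]; rewrite {1}CE inE.
Qed.

Lemma self_dual_linear C x u v : C \in self_dual_codes n ->
  u \in C -> v \in C -> x *: u + v \in C.
Proof.
rewrite inE => /andP[/andP[_ /forallP/(_ x)/forall_inP lin] _] Cu Cv.
by have /forall_inP := lin u Cu; apply.
Qed.

Lemma self_dual0 C : C \in self_dual_codes n -> 0 \in C.
Proof. by rewrite inE => /andP[/andP[]]. Qed.

Lemma self_dualP C : 0 \in C ->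
  (forall x u v, u \in C -> v \in C -> x *: u + v \in C) ->
  (forall u, (u \in C) = [forall v in C, dotv u v == 0]) ->
  C \in self_dual_codes n.
Proof.
move=> C0 lin dual; rewrite inE /linear_code C0 /=; apply/andP; split.
  apply/forallP => x; apply/forall_inP => u Cu; apply/forall_inP => v Cv.
  exact: lin.
by apply/eqP/setP => u; rewrite dual inE.
Qed.

Lemma transvection_self_dual a C : dotv a a = 0 ->
  C \in self_dual_codes n ->
  finset (fun u => transvection a u \in C) \in self_dual_codes n.
Proof.
move=> aa sdC; apply: self_dualP => [|x u v|u].
- by rewrite inE /transvection dotvC dotv0 scale0r addr0 self_dual0.
- by rewrite !inE transvection_linear; apply: self_dual_linear.
rewrite inE (self_dual_memE _ sdC); apply/forall_inP/forall_inP => uC v Cv.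
  by rewrite inE in Cv; rewrite -[u](transvectionK aa) transvection_dot ?uC.
by rewrite transvection_dot // uC // inE transvectionK.
Qed.

Definition codes_through c :=
  #|finset (fun C : {set 'rV['F_2]_n} => (C \in self_dual_codes n) && (c \in C))|.

Lemma codes_through_transvection a c : dotv a a = 0 ->
  (codes_through c <= codes_through (transvection a c))%N.
Proof.
move=> aa; pose F C := finset (fun u => transvection a u \in C).
have FK : involutive F.
  by move=> C; apply/setP => u; rewrite !inE transvectionK.
rewrite [leqLHS]/codes_through -(card_imset _ (inv_inj FK)).
apply/subset_leq_card/fintype.subsetP => D.
case/imsetP => C; rewrite inE => /andP[sdC Cc] ->.
by rewrite inE transvection_self_dual // inE transvectionK.
Qed.

(** If [u . v = 1], the transvection along [u + v] exchanges [u] and [v]. *)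
Lemma codes_through_eq_dot1 u v : dotv u u = 0 -> dotv v v = 0 ->
  dotv u v = 1 -> codes_through u = codes_through v.
Proof.
have le u' v' : dotv u' u' = 0 -> dotv v' v' = 0 -> dotv u' v' = 1 ->
    (codes_through u' <= codes_through v')%N.
  move=> uu vv uv.
  have aa : dotv (u' + v') (u' + v') = 0.
    by rewrite dotvDl !dotvDr uu vv [dotv v' u']dotvC add0r addr0 F2_addrr.
  have := codes_through_transvection u' aa.
  by rewrite /transvection dotvDr uu uv add0r scale1r addrA addvv add0r.
by move=> uu vv uv; apply/eqP; rewrite eqn_leq !le // dotvC.
Qed.

Definition nonconstant u := [exists i, exists j, u 0 i != u 0 j].

(** If a pair separated by [u] is not separated by [v], replace one of its two
    ends by a coordinate at which [v] takes its other value. *)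
Lemma common_separator u v : nonconstant u -> nonconstant v ->
  exists i j, u 0 i != u 0 j /\ v 0 i != v 0 j.
Proof.
case/existsP => i /existsP[j uij] /existsP[i' /existsP[j' vij']].
have [vij|] := eqVneq (v 0 i) (v 0 j); last by exists i, j.
have [l vil] : exists l, v 0 i != v 0 l.
  have [vii'|] := eqVneq (v 0 i) (v 0 i'); last by exists i'.
  by exists j'; rewrite vii'.
have [uil|] := eqVneq (u 0 i) (u 0 l); last by exists i, l.
by exists j, l; rewrite -vij -uil eq_sym.
Qed.

(** When [u] and [v] are orthogonal, go through a vector of weight two on a
    pair of coordinates that separates both: its inner product with [u] and
    with [v] is 1. *)
Lemma codes_through_eq u v : dotv u u = 0 -> dotv v v = 0 ->
  nonconstant u -> nonconstant v -> codes_through u = codes_through v.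
Proof.
move=> uu vv nu nv; have [i [j [uij vij]]] := common_separator nu nv.
pose w := delta_mx 0 i + delta_mx 0 j : 'rV['F_2]_n.
have dotw (x : 'rV['F_2]_n) : x 0 i != x 0 j -> dotv x w = 1.
  rewrite /w dotvDr !dotv_delta.
  case: (F2_cases (x 0 i)) (F2_cases (x 0 j)) => -> [] ->;
    by rewrite ?eqxx // ?add0r ?addr0.
have ww : dotv w w = 0.
  rewrite dotvDr !dotv_delta !mxE eqxx /= !eqxx.
  by rewrite [j == i]eq_sym; case: (i == j); apply/val_inj.
by rewrite (codes_through_eq_dot1 uu ww) ?dotw ?(codes_through_eq_dot1 vv ww) ?dotw.
Qed.

Lemma constantP u : ~~ nonconstant u -> u = 0 \/ u = const_mx 1.
Proof.
move=> nc; case: (pickP (fun _ : 'I_n => true)) => [i0 _|none]; last first.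
  by left; apply/rowP => i; have := none i.
have cst i : u 0 i = u 0 i0.
  apply/eqP; apply: contraR nc => uij; apply/existsP; exists i.
  by apply/existsP; exists i0.
by case: (F2_cases (u 0 i0)) => u0; [left|right]; apply/rowP => i;
  rewrite mxE cst u0.
Qed.

Lemma self_dual_even C c : C \in self_dual_codes n -> c \in C -> dotv c c = 0.
Proof.
by move=> sdC Cc; have := Cc; rewrite (self_dual_memE _ sdC) => /forall_inP/(_ c Cc)/eqP.
Qed.

Lemma dotv_ones c : dotv (const_mx 1) c = dotv c c.
Proof. by rewrite dotv_diag; apply: eq_bigr => i _; rewrite mxE mul1r. Qed.

(** Over the two-element field [1 . c = c . c], which vanishes on a self-dual
    code, so the all-one vector is in the dual. *)
Lemma self_dual_ones C : C \in self_dual_codes n -> const_mx 1 \in C.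
Proof.
move=> sdC; rewrite (self_dual_memE _ sdC); apply/forall_inP => c Cc.
by rewrite dotv_ones (self_dual_even sdC).
Qed.

Section Characters.
Variable R : realFieldType.

(** The nontrivial additive character of the two-element field. *)
Definition chi (x : 'F_2) : R := if x == 0 then 1 else -1.

Lemma chiD x y : chi (x + y) = chi x * chi y.
Proof.
rewrite /chi; case: (F2_cases x) (F2_cases y) => -> [] ->;
by rewrite ?addr0 ?add0r ?F2_addrr ?eqxx ?oner_eq0 ?mul1r ?mulr1 ?mulrNN ?mulr1.
Qed.

Lemma chi_sum I (r : seq I) (f : I -> 'F_2) :
  chi (\sum_(i <- r) f i) = \prod_(i <- r) chi (f i).
Proof. by apply: (big_morph chi chiD); rewrite /chi eqxx. Qed.

Lemma sum_rV_prod (f : 'I_n -> 'F_2 -> R) :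
  \sum_(c : 'rV['F_2]_n) \prod_i f i (c 0 i) = \prod_i (f i 0 + f i 1).
Proof.
transitivity (\prod_i \sum_(x : 'F_2) f i x).
  rewrite bigA_distr_bigA /= (reindex (fun h : {ffun 'I_n -> 'F_2} => \row_i h i)) /=.
    by apply: eq_bigr => h _; apply: eq_bigr => i _; rewrite mxE.
  exists (fun c : 'rV['F_2]_n => [ffun i => c 0 i]) => h _.
    by apply/ffunP => i; rewrite ffunE mxE.
  by apply/rowP => i; rewrite mxE ffunE.
apply: eq_bigr => i _; rewrite big_ord_recl big_ord1.
by congr (f i _ + f i _); apply/val_inj.
Qed.

(** This is the weight enumerator of the even-weight code; the factor
    [(1 + chi (c . c)) / 2] selects the even vectors. *)
Lemma sum_even_prod (x y : R) :
  \sum_(c : 'rV['F_2]_n | dotv c c == 0) \prod_i (if c 0 i == 0 then x else y) =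
  ((x + y) ^+ n + (x - y) ^+ n) / 2.
Proof.
pose f z := if z == 0 :> 'F_2 then x else y.
have -> : \sum_(c : 'rV['F_2]_n | dotv c c == 0) \prod_i f (c 0 i) =
   (\sum_(c : 'rV['F_2]_n) \prod_i f (c 0 i) +
    \sum_(c : 'rV['F_2]_n) \prod_i (chi (c 0 i) * f (c 0 i))) / 2.
  rewrite -big_split mulr_suml big_mkcond; apply: eq_bigr => c _ /=.
  by rewrite big_split /= -chi_sum -dotv_diag /chi; case: eqP => _; lra.
rewrite (sum_rV_prod (fun=> f)) (sum_rV_prod (fun _ z => chi z * f z)).
rewrite !prodr_const card_ord /f /chi eqxx oner_eq0.
by rewrite mul1r mulN1r.
Qed.

(** Orthogonality of characters: translating by a codeword not orthogonal to
    [u] changes the sign of the sum. *)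
Lemma sum_code_chi C u : C \in self_dual_codes n ->
  \sum_(c in C) chi (dotv u c) = if u \in C then #|C|%:R else 0.
Proof.
move=> sdC; rewrite (self_dual_memE _ sdC); case: ifPn => [/forall_inP uC|].
  rewrite (eq_bigr (fun=> 1)) ?sumr_const // => c /uC uc.
  by rewrite /chi uc.
rewrite negb_forall_in => /exists_inP[c0 Cc0 uc0].
set S := \sum_(c in C) _; suff : S = - S by lra.
rewrite {1}/S (reindex_inj (addrI c0)) -sumrN; apply: eq_big => [c|c _] /=.
  apply/idP/idP => Cc; last by rewrite -[c0]scale1r self_dual_linear.
  rewrite -[c]add0r -(addvv c0) -addrA -{1}[c0]scale1r.
  exact: self_dual_linear.
by rewrite dotvDr chiD {1}/chi (negPf uc0) mulN1r.
Qed.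

(** Evaluate the double sum of [chi (u . c)], over all vectors [u] and over [c]
    in [C], in both orders. *)
Lemma card_self_dual C : C \in self_dual_codes n -> (#|C| ^ 2)%N = (2 ^ n)%N.
Proof.
move=> sdC; apply/eqP; rewrite -(eqr_nat R) !natrX; apply/eqP.
transitivity (\sum_u \sum_(c in C) chi (dotv u c)).
  rewrite (eq_bigr _ (fun u _ => sum_code_chi u sdC)) -big_mkcond /=.
  by rewrite sumr_const expr2 mulr_natr.
rewrite exchange_big (bigD1 0) ?self_dual0 //= [X in _ + X]big1 => [|c /andP[_ c0]].
  rewrite addr0 (eq_bigr (fun=> 1)) => [|u _]; last by rewrite dotv0 /chi eqxx.
  by rewrite sumr_const card_mx card_Fp // mul1n natrX.
rewrite (eq_bigr _ (fun u _ => chi_sum _ _)).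
rewrite (sum_rV_prod (fun i x => chi (x * c 0 i))).
have [i ci] : exists i, c 0 i != 0.
  apply/existsP; apply: contraR c0 => /existsPn cz.
  by apply/eqP/rowP => i; rewrite mxE; apply/eqP; rewrite -[_ == _]negbK cz.
rewrite (bigD1 i) //= mul0r mul1r (F2_neq0 ci) /chi eqxx oner_eq0 subrr.
by rewrite mul0r.
Qed.

End Characters.

(** Vectors of odd weight contribute nothing because a self-dual code is
    even. *)
Lemma sum_codes_through (R : realFieldType) (g : 'rV['F_2]_n -> R) :
  \sum_(C in self_dual_codes n) \sum_(c in C) g c =
  \sum_(c | dotv c c == 0) (codes_through c)%:R * g c.
Proof.
rewrite (exchange_big_dep xpredT) //= [RHS]big_mkcond; apply: eq_bigr => c _.
rewrite sumr_const mulr_natl; case: ifPn => [_|odd_c].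
  by congr (_ *+ _); apply: eq_card => C; rewrite inE.
rewrite (_ : #|_| = 0%N) //; apply: eq_card0 => C; rewrite inE /=.
by apply/andP => -[sdC Cc]; rewrite (self_dual_even sdC Cc) eqxx in odd_c.
Qed.

Lemma codes_through_all c : (forall C, C \in self_dual_codes n -> c \in C) ->
  codes_through c = #|self_dual_codes n|.
Proof.
move=> all_c; apply: eq_card => C; rewrite inE.
by case sdC: (C \in self_dual_codes n); rewrite // all_c.
Qed.

(** An even vector other than 0 and the all-one vector lies in a common number
    [N0] of self-dual codes, while 0 and the all-one vector lie in all of them.
    Taking [g = 1] gives [N0 * (2 ^ (k - 1) + 1) = #|A|]. *)
Lemma average_self_dual (R : realFieldType) (k : nat) (g : 'rV['F_2]_n -> R) :
  n = k.*2 -> (1 < k)%N ->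
  (2 ^+ k.-1 + 1) * (\sum_(C in self_dual_codes n) \sum_(c in C) g c) =
  #|self_dual_codes n|%:R *
    (\sum_(c | dotv c c == 0) g c + 2 ^+ k.-1 * (g 0 + g (const_mx 1))).
Proof.
move=> n2k k1; set A := self_dual_codes n.
(* If there is no such vector, any [N0] will do: the counting below does not
   distinguish this case. *)
have [N0 N0E] : exists N0, forall c, dotv c c == 0 -> nonconstant c ->
    codes_through c = N0.
  case: (pickP (fun c => (dotv c c == 0) && nonconstant c)) => [c0|none].
    move=> /andP[/eqP c00 nc0]; exists (codes_through c0) => c /eqP cc nc.
    exact: codes_through_eq.
  by exists 0%N => c cc nc; have := none c; rewrite cc nc.
have ones0 : (const_mx 1 == 0 :> 'rV['F_2]_n) = false.
  have n0 : (0 < n)%N by rewrite n2k double_gt0 (ltn_trans _ k1).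
  apply/negP => /eqP/rowP/(_ (Ordinal n0)); rewrite !mxE => /eqP.
  by rewrite oner_eq0.
have ones_even : dotv (const_mx 1 : 'rV['F_2]_n) (const_mx 1) = 0.
  rewrite dotv_diag (eq_bigr (fun=> 1)) => [|i _]; last by rewrite mxE.
  rewrite sumr_const card_ord n2k -mul2n natrM.
  by rewrite (_ : 2%:R = 0 :> 'F_2) ?mul0r //; apply/val_inj.
have total h : \sum_(C in A) \sum_(c in C) h c =
    N0%:R * \sum_(c | dotv c c == 0) h c +
    (#|A|%:R - N0%:R) * (h 0 + h (const_mx 1)) :> R.
  rewrite sum_codes_through !(bigD1 (P := fun c => dotv c c == 0) 0) ?dotv0 //=.
  rewrite !(bigD1 (P := fun c => (dotv c c == 0) && _) (const_mx 1)) /=; last first.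
  - by rewrite ones_even ones0 eqxx.
  - by rewrite ones_even ones0 eqxx.
  rewrite !codes_through_all; try exact: self_dual0; try exact: self_dual_ones.
  rewrite (eq_bigr (fun c => N0%:R * h c)) => [|c /andP[/andP[cc c0] c1]].
    by rewrite -mulr_sumr; ring.
  congr (_%:R * _); apply: N0E => //; apply: contraT => /constantP[] cE.
    by rewrite cE eqxx in c0.
  by rewrite cE eqxx in c1.
pose y : R := 2 ^+ k.-1.
have kE : k = k.-1.+1 by rewrite (ltn_predK k1).
have AE : #|A|%:R = N0%:R * (y + 1).
  have sizeC C : C \in A -> #|C| = (2 ^ k)%N.
    move=> /(card_self_dual R) cardC; apply/eqP; rewrite -(eqn_exp2r _ _ (ltn0Sn 1)).
    by rewrite cardC n2k -expnM muln2.
  have := total (fun=> 1).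
  rewrite (eq_bigr (fun=> 2 ^+ k)) => [|C AC]; last first.
    by rewrite sumr_const (sizeC _ AC) natrX.
  have -> : \sum_(c : 'rV['F_2]_n | dotv c c == 0) 1 = 2 ^+ n / 2 :> R.
    have n0 : (n == 0%N) = false by rewrite n2k kE.
    have := @sum_even_prod R 1 1; rewrite subrr expr0n n0 addr0 => <-.
    by apply: eq_bigr => c _; rewrite big1 // => i _; case: ifP.
  rewrite sumr_const (_ : 2 ^+ n = (2 ^+ k) ^+ 2); last by rewrite n2k -muln2 exprM.
  have -> : 2 ^+ k = 2 * y by rewrite {1}kE exprS.
  rewrite -mulr_natr => eqN.
  have y1 : y - 1 != 0.
    by rewrite subr_eq0 gt_eqF // exprn_egt1 ?ltr1n // -lt0n -ltnS -kE.
  by apply: (mulfI y1); lra.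
rewrite total -/y AE; ring.
Qed.

End BinaryVectors.

(** * A convexity inequality for symmetric sums of powers *)

Section SymmetricPower.
Variable R : realFieldType.
Implicit Types p x y z : R.

Definition sympow k p x := (p + x) ^+ k + (p - x) ^+ k.

(** Only even powers of [x] survive, with nonnegative coefficients; this is the
    source of the convexity in [x ^ 2]. *)
Lemma sympowE k p x : sympow k p x =
  \sum_(i < k.+1 | ~~ odd i) (p ^+ (k - i) * (x ^+ 2) ^+ i./2) *+ ('C(k, i)).*2.
Proof.
rewrite /sympow !exprDn -big_split [RHS]big_mkcond; apply: eq_bigr => i _ /=.
rewrite exprNn -mulrnDl; case: ifPn => [ev|/negPn od].
  rewrite -signr_odd (negPf ev) expr0 mul1r -exprM mul2n even_halfK //.
  by rewrite -mul2n mulrnA mulr2n.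
by rewrite -signr_odd od expr1 mulN1r mulrN subrr mul0rn.
Qed.

(** The induction step is Chebyshev's inequality for the similarly ordered
    pairs [(x, y)] and [(x ^ j, y ^ j)]. *)
Lemma power_mean j x y : 0 <= x -> 0 <= y ->
  ((x + y) / 2) ^+ j *+ 2 <= x ^+ j + y ^+ j.
Proof.
move=> x0 y0; elim: j => [|j IH]; first by rewrite !expr0 mulr2n.
have cheb : 0 <= (x - y) * (x ^+ j - y ^+ j).
  case: (leP x y) => [xy|/ltW yx].
    by rewrite mulr_le0 ?subr_le0 // lerXn2r ?nnegrE.
  by rewrite mulr_ge0 ?subr_ge0 // lerXn2r ?nnegrE.
have m0 : 0 <= (x + y) / 2 by rewrite divr_ge0 ?addr_ge0.
have := ler_wpM2l m0 IH; rewrite mulrnAr !exprS => /le_trans; apply.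
lra.
Qed.

Lemma sympow_le k p x y x' y' : 0 <= p ->
  (forall j, (x ^+ 2) ^+ j + (y ^+ 2) ^+ j <= (x' ^+ 2) ^+ j + (y' ^+ 2) ^+ j) ->
  sympow k p x + sympow k p y <= sympow k p x' + sympow k p y'.
Proof.
move=> p0 le; rewrite !sympowE -!big_split; apply: ler_sum => i _ /=.
by rewrite -!mulrnDl -!mulrDr lerMn2r ler_wpM2l ?orbT ?exprn_ge0.
Qed.

(** Jensen's inequality for [sympow k p] as a function of [x ^ 2]. *)
Lemma sympow_ge_diag k p x y z : 0 <= p -> x ^+ 2 + y ^+ 2 = z ^+ 2 *+ 2 ->
  sympow k p z *+ 2 <= sympow k p x + sympow k p y.
Proof.
move=> p0 eq_z; rewrite mulr2n; apply: sympow_le => // j; rewrite -mulr2n.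
have -> : z ^+ 2 = (x ^+ 2 + y ^+ 2) / 2 by rewrite eq_z -mulr_natr mulfK ?pnatr_eq0.
by apply: power_mean; apply: sqr_ge0.
Qed.

(** A convex function of [x ^ 2] on [0, p ^ 2] lies below its chord. *)
Lemma sympow_le_ends k p x y : 0 <= p -> x ^+ 2 + y ^+ 2 = p ^+ 2 ->
  sympow k p x + sympow k p y <= sympow k p 0 + sympow k p p.
Proof.
move=> p0 eq_p; apply: sympow_le => // -[|j]; first by rewrite !expr0.
rewrite [0 ^+ 2]expr0n /= expr0n add0r -eq_p.
elim: j => [|j IH]; first by rewrite !expr1.
rewrite [leRHS]exprS; apply: le_trans (ler_wpM2l _ IH); last first.
  by rewrite addr_ge0 ?sqr_ge0.
rewrite mulrDl !mulrDr -!exprS -!addrA lerD2l addrA lerDr.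
by apply: addr_ge0; apply: mulr_ge0; do ?[exact: sqr_ge0 | apply: exprn_ge0].
Qed.

End SymmetricPower.

(** * Unordered sums of nonnegative terms *)

Section UnorderedSums.
Local Open Scope classical_set_scope.
Variable R : realType.

Lemma esumZl (T : choiceType) (D : set T) (a : T -> \bar R) (c : R) :
  0 <= c -> (forall t, 0 <= a t)%E ->
  (\esum_(t in D) (c%:E * a t) = c%:E * \esum_(t in D) a t)%E.
Proof.
move=> c0 a0; rewrite /esum -ereal_supZl //; last first.
  by apply/set0P; eexists; exists set0 => //; exact: fsets_set0.
rewrite image_comp; congr ereal_sup; apply: eq_imagel => F _ /=.
by rewrite ge0_mule_fsumr.
Qed.

Definition has_sum (T : choiceType) (f : T -> R) (S : R) :=
  (\esum_(t in [set: T]) (f t)%:E = S%:E)%E.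

Lemma esum_setTX (T1 T2 : choiceType) (f : T1 -> T2 -> \bar R) :
  (forall x y, 0 <= f x y)%E ->
  (\esum_(x in [set: T1]) \esum_(y in [set: T2]) f x y =
   \esum_(p in [set: T1 * T2]) f p.1 p.2)%E.
Proof.
move=> f0; rewrite esum_esum // (_ : [set: T1] `*`` _ = [set: T1 * T2]) //.
by apply/seteqP; split.
Qed.

Lemma has_sum_prod (T1 T2 : choiceType) (f : T1 -> R) (g : T2 -> R) (S S' : R) :
  (forall x, 0 <= f x) -> (forall y, 0 <= g y) ->
  has_sum f S -> has_sum g S' ->
  has_sum (fun p : T1 * T2 => f p.1 * g p.2) (S * S').
Proof.
move=> f0 g0 fS gS.
have g_ge0 : 0 <= S' by rewrite -lee_fin -gS esum_ge0 // => y _; rewrite lee_fin.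
rewrite /has_sum -(@esum_setTX _ _ (fun x y => (f x * g y)%:E)); last first.
  by move=> x y; rewrite lee_fin mulr_ge0.
transitivity (\esum_(x in [set: T1]) (S'%:E * (f x)%:E)%E).
  apply: eq_esum => x _ /=.
  transitivity (\esum_(y in [set: T2]) ((f x)%:E * (g y)%:E)%E); first by [].
  rewrite esumZl ?gS; first by rewrite muleC.
    exact: f0.
  by move=> y; rewrite lee_fin.
rewrite esumZl ?fS; first by rewrite -EFinM mulrC.
  exact: g_ge0.
by move=> x; rewrite lee_fin.
Qed.

Lemma has_sum_reindex (T T' : choiceType) (e : T -> T') (f : T' -> R) (S : R) :
  bijective e -> has_sum f S <-> has_sum (f \o e) S.
Proof.
case=> e' eK e'K; rewrite /has_sum (@reindex_esum _ _ _ [set: T] _ e) //; split=> //.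
- by move=> x y _ _; exact: (can_inj eK).
- by move=> y _; exists (e' y).
Qed.

Lemma has_sum_fin (T : choiceType) (f g : T -> R) (S : R) :
  (forall t, 0 <= f t <= g t) -> has_sum g S -> exists S', has_sum f S'.
Proof.
move=> fg gS.
have : (0 <= \esum_(t in [set: T]) (f t)%:E)%E.
  by apply: esum_ge0 => t _; rewrite lee_fin; have /andP[] := fg t.
have : (\esum_(t in [set: T]) (f t)%:E <= S%:E)%E.
  by rewrite -gS; apply: le_esum => t _; rewrite lee_fin; have /andP[] := fg t.
by rewrite /has_sum; case: (esum _ _) => // s _ _; exists s.
Qed.

Lemma has_sum_unique (T : choiceType) (f : T -> R) (S S' : R) :
  has_sum f S -> has_sum f S' -> S = S'.
Proof. by rewrite /has_sum => -> []. Qed.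

Lemma has_sumE (T : choiceType) (f g : T -> R) (S : R) :
  f =1 g -> has_sum f S -> has_sum g S.
Proof. by move=> fg; rewrite /has_sum => <-; apply: eq_esum => t _; rewrite fg. Qed.

Lemma has_sumZ (T : choiceType) (f : T -> R) (c S : R) :
  0 <= c -> (forall t, 0 <= f t) -> has_sum f S -> has_sum (fun t => c * f t) (c * S).
Proof.
by move=> c0 f0 fS; rewrite /has_sum EFinM -fS -esumZl.
Qed.

Lemma has_sum_split (T T1 T2 : choiceType) (e1 : T1 -> T) (e2 : T2 -> T)
    (f : T -> R) (S1 S2 : R) :
  (forall t, 0 <= f t) -> injective e1 -> injective e2 ->
  (forall x y, e1 x <> e2 y) ->
  (forall t, (exists x, t = e1 x) \/ (exists y, t = e2 y)) ->
  has_sum (f \o e1) S1 -> has_sum (f \o e2) S2 -> has_sum f (S1 + S2).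
Proof.
move=> f0 inj1 inj2 disj cover f1 f2.
rewrite /has_sum (esumID (range e1)) => [|t _]; last by rewrite lee_fin.
rewrite !setTI (_ : ~` range e1 = range e2); last first.
  apply/seteqP; split => t /=.
    by case: (cover t) => [[x ->]|[y ->]] ne; [case: ne; exists x | exists y].
  by case=> y _ <- [x _ /disj].
by rewrite !esum_image ?f1 ?f2 // => x y _ _; [exact: inj2|exact: inj1].
Qed.

(** Expanding a product of series over the integers into a series over the
    integer lattice: peel off the first coordinate. *)
Lemma has_sum_row n (f : 'I_n -> int -> R) (S : 'I_n -> R) :
  (forall i v, 0 <= f i v) -> (forall i, has_sum (f i) (S i)) ->
  has_sum (fun z : 'rV[int]_n => \prod_i f i (z 0 i)) (\prod_i S i).
Proof.
elim: n f S => [|n IH] f S f0 fS.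
  rewrite /has_sum big_ord0 (_ : [set: 'rV[int]_0] = [set 0]).
    by rewrite esum_set1 big_ord0 ?lee_fin.
  by apply/seteqP; split => // z _; apply/rowP => -[].
pose e (p : int * 'rV[int]_n) : 'rV[int]_n.+1 :=
  \row_i (if unlift ord0 i is Some j then p.2 0 j else p.1).
have e0 p : e p 0 ord0 = p.1 by rewrite mxE unlift_none.
have eS p j : e p 0 (lift ord0 j) = p.2 0 j by rewrite mxE liftK.
apply/(@has_sum_reindex _ _ e).
  exists (fun z : 'rV[int]_n.+1 => (z 0 ord0, \row_j z 0 (lift ord0 j))) => [[v w]|z].
    by rewrite e0; congr (_, _); apply/rowP => j; rewrite mxE eS.
  apply/rowP => i; case: (unliftP ord0 i) => [j ->|->]; rewrite ?eS ?e0 ?mxE //.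
rewrite big_ord_recl.
have := has_sum_prod (f0 ord0) _ (fS ord0)
  (IH (fun j => f (lift ord0 j)) _ (fun j => f0 _) (fun j => fS _)).
move=> /(_ (fun _ => prodr_ge0 _ (fun j _ => f0 _ _))); apply: has_sumE => p /=.
rewrite big_ord_recl e0; congr (_ * _); apply: eq_bigr => j _.
by rewrite eS.
Qed.

End UnorderedSums.

(** * Riemann sums of the Gaussian *)

Section GaussianRiemannSum.
Local Open Scope classical_set_scope.
Variable R : realType.
Local Notation mu := (@lebesgue_measure R).

Lemma gauss_fun_decr (x y : R) : 0 <= x -> x <= y -> gauss_fun y <= gauss_fun x.
Proof.
by move=> x0 xy; rewrite ler_expR lerN2 lerXn2r ?nnegrE // (le_trans x0).
Qed.

Lemma measurable_gauss_EFin (D : set R) :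
  measurable_fun D (EFin \o @gauss_fun R).
Proof.
by apply/measurable_EFinP/measurable_funTS; exact: measurable_gauss_fun.
Qed.

Section Mesh.
Variables (h : R) (h_gt0 : 0 < h).
(* Half-open cells, so that they partition the half-line. *)
Let cell (j : nat) : set R := `[j%:R * h, j.+1%:R * h[.

Lemma integral_const_cell j (c : R) :
  (\int[mu]_(x in cell j) c%:E = (h * c)%:E)%E.
Proof.
have meas : measurable (cell j) by exact: measurable_itv.
have /= := integral_cst mu meas c%:E.
have -> : mu (cell j) = h%:E.
  rewrite lebesgue_measure_itv /= lte_fin ltr_pM2r // ltr_nat ltnSn -EFinB -mulrBl.
  by rewrite -natrB // subSnn mul1r.
by move=> ->; rewrite -EFinM mulrC.
Qed.

Lemma integral_cell_gauss j :
  ((h * gauss_fun (j.+1%:R * h))%:E <= \int[mu]_(x in cell j) (gauss_fun x)%:E)%E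
  /\ (\int[mu]_(x in cell j) (gauss_fun x)%:E <= (h * gauss_fun (j%:R * h))%:E)%E.
Proof.
have meas : measurable (cell j) by exact: measurable_itv.
have jh0 : 0 <= j%:R * h by rewrite mulr_ge0 // ltW.
rewrite -!(integral_const_cell j); split; apply: ge0_le_integral => //=;
  try (by move=> x _; rewrite lee_fin gauss_fun_ge0);
  try exact: measurable_gauss_EFin;
  move=> x; rewrite /cell /= in_itv /= => /andP[jx xj]; rewrite lee_fin.
  by apply: gauss_fun_decr; [exact: le_trans jx | exact: ltW].
exact: gauss_fun_decr.
Qed.

Lemma integral_cells_gauss :
  (\sum_(0 <= j <oo) \int[mu]_(x in cell j) (gauss_fun x)%:E =
   (Num.sqrt pi / 2)%:E)%E.
Proof.
rewrite -integral0y_gauss -ge0_integral_bigcup; first last.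
- apply: ltn_trivIset => m j jm; rewrite -subset0 => x [] /=.
  rewrite /cell /= !in_itv /= => /andP[_ xj] /andP[mx _].
  have := le_lt_trans mx xj; rewrite ltr_pM2r // ltr_nat ltnS => mj.
  by have := leq_ltn_trans mj jm; rewrite ltnn.
- by move=> x _; rewrite lee_fin gauss_fun_ge0.
- exact: measurable_gauss_EFin.
- by move=> j; exact: measurable_itv.
congr (integral _ _ _); apply/seteqP; split => x /=.
  case=> j _; rewrite /cell /= !in_itv /= andbT => /andP[jx _].
  by apply: le_trans jx; rewrite mulr_ge0 // ltW.
rewrite in_itv /= andbT => x0; have xh0 : 0 <= x / h by rewrite divr_ge0 // ltW.
have /andP[jx xj] := truncn_itv xh0.
exists (Num.truncn (x / h)) => //=; rewrite /cell /= in_itv /=.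
by rewrite -ler_pdivlMr // jx -ltr_pdivrMr.
Qed.

(** The Gaussian decreases on the half-line, so its integral lies between the
    Riemann sums with right and left endpoints; these differ by the single term
    at 0. *)
Lemma gauss_sum_bounds : exists S : R,
  [/\ 0 <= S, (\sum_(0 <= j <oo) (gauss_fun (j.+1%:R * h))%:E = S%:E)%E,
      h * S <= Num.sqrt pi / 2 & Num.sqrt pi / 2 <= h * (S + 1)].
Proof.
set T := (\sum_(0 <= j <oo) (gauss_fun (j.+1%:R * h))%:E)%E.
have T0 : (0 <= T)%E by apply: nneseries_ge0 => j _ _; rewrite lee_fin gauss_fun_ge0.
have upper : (h%:E * T <= (Num.sqrt pi / 2)%:E)%E.
  rewrite -integral_cells_gauss /T -nneseriesZl => [|j _].
    apply: lee_nneseries => [j _ _|j _].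
      by rewrite -EFinM lee_fin mulr_ge0 ?gauss_fun_ge0 // ltW.
    by rewrite -EFinM; have [] := integral_cell_gauss j.
  by rewrite lee_fin gauss_fun_ge0.
have lower : ((Num.sqrt pi / 2)%:E <= h%:E * (1%:E + T))%E.
  rewrite -integral_cells_gauss.
  have -> : (1%:E + T = \sum_(0 <= j <oo) (gauss_fun (j%:R * h))%:E)%E.
    rewrite [RHS]nneseries_recl // => [|j _]; last by rewrite lee_fin gauss_fun_ge0.
    rewrite mul0r {1}/gauss_fun expr0n oppr0 expR0; congr (_ + _)%E.
    rewrite /T -(@nneseries_addn _ (fun j => (gauss_fun (j%:R * h))%:E) 1).
      by apply: eq_eseriesr => j _; rewrite addn1.
    by move=> j; rewrite lee_fin gauss_fun_ge0.
  rewrite -nneseriesZl => [|j _]; last by rewrite lee_fin gauss_fun_ge0.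
  apply: lee_nneseries => [j _ _|j _].
    by apply: integral_ge0 => x _; rewrite lee_fin gauss_fun_ge0.
  by rewrite -EFinM; have [] := integral_cell_gauss j.
move: T0 upper lower; case: T => [S| |] //=.
  by rewrite -EFinD -!EFinM !lee_fin [1 + S]addrC => *; exists S.
by move=> _; rewrite gt0_muley // ?lte_fin.
Qed.

End Mesh.
End GaussianRiemannSum.

(** * Theta constants with a shift, and their duplication formulas *)

Section ShiftedTheta.
Local Open Scope classical_set_scope.
Variable R : realType.
Implicit Types s t tau : R.

(** The shifts 0 and 1/2 give the terms of theta_3 and theta_2 at [i tau]. *)
Definition theta_term s tau (v : int) : R := expR (- (pi * tau * (v%:~R + s) ^+ 2)).

Definition theta s tau : R :=
  fine (\esum_(v in [set: int]) (theta_term s tau v)%:E).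

Lemma theta_term_ge0 s tau v : 0 <= theta_term s tau v.
Proof. exact: expR_ge0. Qed.

Lemma theta3E tau : theta3 tau = theta 0 tau.
Proof.
by congr fine; apply: eq_esum => v _; rewrite /theta_term addr0.
Qed.

Lemma thetaP s tau S : has_sum (theta_term s tau) S -> theta s tau = S.
Proof. by rewrite /theta => ->. Qed.

(** [S] is the sum over the positive integers, and the mesh of the Riemann sum
    is [sqrt (pi * tau)]. *)
Lemma theta0_gauss tau : 0 < tau -> exists S : R,
  [/\ has_sum (theta_term 0 tau) (1 + S + S), 0 <= S,
      Num.sqrt tau * S <= 1 / 2 & 1 / 2 <= Num.sqrt tau * (S + 1)].
Proof.
move=> tau0; have pi0 : 0 < pi :> R := pi_gt0 R.
pose h : R := Num.sqrt (pi * tau).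
have h0 : 0 < h by rewrite sqrtr_gt0 mulr_gt0.
have [S [S0 sumS hS Sh]] := gauss_sum_bounds h0.
have termE (x : R) : gauss_fun (x * h) = expR (- (pi * tau * (x + 0) ^+ 2)).
  by rewrite /gauss_fun exprMn sqr_sqrtr ?mulr_ge0 ?ltW // addr0 mulrC.
have natS : has_sum (fun j : nat => gauss_fun (j.+1%:R * h)) S.
  by rewrite /has_sum -sumS nneseries_esumT // => j; rewrite lee_fin gauss_fun_ge0.
exists S; split=> //; last 2 first.
- move: hS; rewrite /h sqrtrM ?(ltW pi0) // mulrAC -mulrA ler_pM2l ?sqrtr_gt0 //.
  by rewrite div1r mulrC.
- move: Sh; rewrite /h sqrtrM ?(ltW pi0) // -mulrA ler_pM2l ?sqrtr_gt0 //.
  by rewrite div1r.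
apply: (@has_sum_split _ _ _ _ Posz Negz) => //.
- by move=> v; exact: theta_term_ge0.
- by move=> i j [].
- by move=> i j [].
- by case=> j; [left|right]; exists j.
- apply: (@has_sum_split _ _ unit nat (fun=> 0%N) succn).
  + by move=> j; exact: theta_term_ge0.
  + by move=> [] [].
  + by move=> i j [].
  + by [].
  + by case=> [|j]; [left; exists tt|right; exists j].
  + rewrite /has_sum (_ : [set: unit] = [set tt]).
      by rewrite esum_set1 /theta_term /= ?addr0 ?expr0n ?mulr0 ?oppr0 ?expR0 ?lee_fin.
    by apply/seteqP; split => // -[].
  + by apply: has_sumE natS => j; rewrite termE.
apply: has_sumE natS => j.
by rewrite termE /theta_term /= NegzE mulrNz !addr0 sqrrN.
Qed.

(** Convergence follows from that of the unshifted series since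
    [(v + s) ^ 2 >= v ^ 2 / 2 - s ^ 2]. *)
Lemma theta_sum s tau : 0 < tau -> has_sum (theta_term s tau) (theta s tau).
Proof.
move=> tau0; have tau20 : 0 < tau / 2 by rewrite divr_gt0.
have [S0 [sumS _ _ _]] := theta0_gauss tau20.
have := has_sumZ (expR_ge0 (pi * tau * s ^+ 2)) (theta_term_ge0 0 (tau / 2)) sumS.
move=> /(@has_sum_fin _ _ (theta_term s tau)) [v|S fS]; last by rewrite (thetaP fS).
rewrite theta_term_ge0 /theta_term -expRD ler_expR addr0.
have : 0 <= pi * tau * ((v%:~R + 2 * s) ^+ 2 / 2).
  by rewrite mulr_ge0 ?divr_ge0 ?sqr_ge0 ?mulr_ge0 ?pi_ge0 ?(ltW tau0).
lra.
Qed.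

Lemma theta_ge0 s tau : 0 <= theta s tau.
Proof. by apply/fine_ge0/esum_ge0 => v _; rewrite lee_fin theta_term_ge0. Qed.

Lemma theta0_ge1 tau : 0 < tau -> 1 <= theta 0 tau.
Proof. by case/theta0_gauss => S [/thetaP -> *]; lra. Qed.

Lemma theta0_bounds tau : 0 < tau ->
  1 - Num.sqrt tau <= Num.sqrt tau * theta 0 tau <= 1 + Num.sqrt tau.
Proof. by case/theta0_gauss => S [/thetaP -> *]; apply/andP; split; lra. Qed.

Lemma theta_periodic s tau : 0 < tau -> theta (s + 1) tau = theta s tau.
Proof.
move=> tau0; apply: thetaP.
have shift_bij : bijective (fun v : int => v + 1).
  by exists (fun v => v - 1) => v; lia.
have /(has_sum_reindex _ _ shift_bij) := theta_sum s tau0.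
apply: has_sumE => v /=.
by rewrite /theta_term intrD -addrA [1 + s]addrC.
Qed.

(** The map [(a, b) |-> (a + b, a - b)] doubles the quadratic form and has for
    image the integer pairs of even sum; the pairs of odd sum are reached by a
    further translation, which changes the shifts by 1/2. *)
Lemma theta_mul s t tau : 0 < tau ->
  theta s tau * theta t tau =
  theta ((s + t) / 2) (2 * tau) * theta ((s - t) / 2) (2 * tau) +
  theta ((s + t + 1) / 2) (2 * tau) * theta ((s - t + 1) / 2) (2 * tau).
Proof.
move=> tau0; have tau20 : 0 < 2 * tau by rewrite mulr_gt0.
have prod u v (c : R) (c0 : 0 < c) := has_sum_prod (theta_term_ge0 u c)
  (theta_term_ge0 v c) (theta_sum u c0) (theta_sum v c0).
apply: has_sum_unique (prod s t _ tau0) _.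
apply: (@has_sum_split _ _ _ _
  (fun p : int * int => (p.1 + p.2, p.1 - p.2))
  (fun p : int * int => (p.1 + p.2 + 1, p.1 - p.2))).
- by move=> p; rewrite mulr_ge0 ?theta_term_ge0.
- by move=> [a b] [c e] /= [] *; congr (_, _); lia.
- by move=> [a b] [c e] /= [] *; congr (_, _); lia.
- by move=> [a b] [c e] /= [] *; lia.
- move=> [x y]; pose a := ((x + y) %/ 2)%Z; pose r := ((x + y) %% 2)%Z.
  have [r0|r1] : r = 0 \/ r = 1 by rewrite /r; lia.
    by left; exists (a, x - a) => /=; congr (_, _); rewrite /r /a in r0 *; lia.
  by right; exists (a, x - a - 1) => /=; congr (_, _); rewrite /r /a in r1 *; lia.
- apply: has_sumE (prod _ _ _ tau20) => -[a b] /=.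
  by rewrite /theta_term -!expRD; congr expR; rewrite intrD intrB; field.
apply: has_sumE (prod _ _ _ tau20) => -[a b] /=.
by rewrite /theta_term -!expRD; congr expR; rewrite intrB !intrD; field.
Qed.

Lemma theta0_sqr tau : 0 < tau ->
  theta 0 tau ^+ 2 = theta 0 (2 * tau) ^+ 2 + theta (1 / 2) (2 * tau) ^+ 2.
Proof.
move=> tau0; rewrite !expr2 theta_mul // subrr !addr0 add0r mul0r.
by [].
Qed.

Lemma theta_half_sqr tau : 0 < tau ->
  theta (1 / 2) tau ^+ 2 = 2 * (theta 0 (2 * tau) * theta (1 / 2) (2 * tau)).
Proof.
move=> tau0; rewrite expr2 theta_mul // subrr mul0r add0r.
have -> : (1 / 2 + 1 / 2 : R) = 1 by lra.
have -> : ((1 + 1) / 2 : R) = 0 + 1 by lra.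
by rewrite theta_periodic ?mulr_gt0 //; ring.
Qed.

End ShiftedTheta.

(** * The arithmetic-geometric mean *)

Section ArithmeticGeometricMean.
Import numFieldNormedType.Exports.
Local Open Scope classical_set_scope.
Variable R : realType.
Implicit Types a b : nat -> R.

Record agm_iteration a b : Prop := AgmIteration {
  agm_a_ge0 : forall j, 0 <= a j;
  agm_b_ge0 : forall j, 0 <= b j;
  agm_a_rec : forall j, a j.+1 = (a j + b j) / 2;
  agm_b_rec : forall j, b j.+1 ^+ 2 = a j * b j }.

(** The iteration is monotone and homogeneous.  The comparison starts at index 1
    because a factor [c > 1] is impossible earlier for two iterations with the
    same first term. *)
Lemma agm_le a b a' b' (c : R) : 0 <= c ->
  agm_iteration a b -> agm_iteration a' b' ->
  c * a 1%N <= a' 1%N -> c * b 1%N <= b' 1%N -> forall j, c * a j.+1 <= a' j.+1.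
Proof.
move=> c0 [a0 b0 aE bE] [a'0 b'0 a'E b'E] a1 b1 j.
suff: c * a j.+1 <= a' j.+1 /\ c * b j.+1 <= b' j.+1 by case.
elim: j => // j [IHa IHb]; split; first by rewrite aE a'E; lra.
rewrite -(@ler_pXn2r _ 2) ?nnegrE ?mulr_ge0 // b'E exprMn bE.
by rewrite expr2 mulrACA ler_pM ?mulr_ge0.
Qed.

(** With a common first term [p], a larger second term [e > d] makes the next
    iterate larger by at least the factor [c = (p + e) / (p + d) > 1] in both
    components, hence also the limit. *)
Lemma agm_inj a b a' b' (l : R) :
  agm_iteration a b -> agm_iteration a' b' ->
  a 0%N = a' 0%N -> 0 < a 0%N -> b 0%N <= a 0%N -> b' 0%N <= a 0%N ->
  0 < l -> a @ \oo --> l -> a' @ \oo --> l -> b 0%N = b' 0%N.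
Proof.
wlog bb' : a b a' b' / b 0%N <= b' 0%N.
  move=> W agm agm' aa' a0 ba b'a l0 al a'l.
  have [bb'|/ltW b'b] := leP (b 0%N) (b' 0%N); first exact: (W a b a' b').
  by apply/esym/(W a' b' a b); rewrite -?aa'.
move=> agm agm' aa' a0 ba b'a l0 al a'l.
set p := a 0%N in aa' a0 ba b'a *; set d := b 0%N in bb' ba *.
set e := b' 0%N in bb' b'a *.
have d0 : 0 <= d := agm_b_ge0 agm 0; have e0 : 0 <= e := agm_b_ge0 agm' 0.
have pd : 0 < p + d by rewrite ltr_wpDr.
have pe : 0 < p + e by rewrite ltr_wpDr.
pose c := (p + e) / (p + d).
have c0 : 0 <= c by rewrite divr_ge0 ?ltW.
have le j : c * a j.+1 <= a' j.+1.
  apply: (agm_le c0 agm agm').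
    rewrite (agm_a_rec agm) (agm_a_rec agm') -aa' -/p -/d -/e /c mulrA.
    by rewrite mulfVK ?gt_eqF.
  rewrite -(@ler_pXn2r _ 2) ?nnegrE ?(mulr_ge0 c0) ?(agm_b_ge0 agm) ?(agm_b_ge0 agm') //.
  rewrite exprMn (agm_b_rec agm) (agm_b_rec agm') -aa' -/p -/d -/e /c.
  (* For the geometric means the claim is [c ^ 2 * p * d <= p * e], that is
     [0 <= p * (e - d) * (p ^ 2 - d * e)]. *)
  rewrite expr_div_n mulrAC ler_pdivrMr ?exprn_gt0 // -subr_ge0.
  rewrite (_ : _ - _ = p * (e - d) * (p * p - d * e)); last by ring.
  by rewrite !mulr_ge0 ?subr_ge0 ?(ltW a0) // ler_pM.
have : c * l <= l.
  apply: (@ler_cvg_to _ \oo _ R (fun j => c * a j.+1) (fun j => a' j.+1)).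
  - by apply: cvgM; [exact: cvg_cst|move: al; rewrite -cvg_shiftS].
  - by move: a'l; rewrite -cvg_shiftS.
  - by apply: nearW => j; exact: le.
rewrite -{2}[l]mul1r ler_pM2r // /c ler_pdivrMr // mul1r lerD2l => ed.
by apply/eqP; rewrite eq_le bb' ed.
Qed.

End ArithmeticGeometricMean.

(** * The self-dual point of the theta constants *)

Section SelfDualPoint.
Import numFieldNormedType.Exports.
Local Open Scope classical_set_scope.
Variable R : realType.
Implicit Types tau : R.

(** By the duplication formulas this is the square of theta_4 at [i tau].  This
    form involves only series of nonnegative terms. *)
Definition theta4_sqr tau : R :=
  theta 0 (2 * tau) ^+ 2 - theta (1 / 2) (2 * tau) ^+ 2.

Lemma theta_half_pow4 tau : 0 < tau ->
  (theta (1 / 2) tau ^+ 2) ^+ 2 =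
  4 * (theta 0 (2 * tau) ^+ 2 * theta (1 / 2) (2 * tau) ^+ 2).
Proof. by move=> tau0; rewrite theta_half_sqr //; ring. Qed.

Lemma jacobi_identity tau : 0 < tau ->
  (theta4_sqr tau) ^+ 2 + (theta (1 / 2) tau ^+ 2) ^+ 2 = (theta 0 tau ^+ 2) ^+ 2.
Proof.
by move=> tau0; rewrite theta_half_pow4 // (theta0_sqr tau0) /theta4_sqr; ring.
Qed.

Lemma theta4_sqr_double tau : 0 < tau ->
  (theta4_sqr (2 * tau)) ^+ 2 = theta 0 tau ^+ 2 * theta4_sqr tau.
Proof.
move=> tau0; have tau20 : 0 < 2 * tau by rewrite mulr_gt0.
have /(canRL (addrK _)) -> := jacobi_identity tau20.
by rewrite (theta0_sqr tau0) /theta4_sqr; ring.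
Qed.

Lemma theta0_sqr_gt0 tau : 0 < tau -> 0 < theta 0 tau ^+ 2.
Proof. by move=> tau0; rewrite exprn_gt0 ?(lt_le_trans ltr01) ?theta0_ge1. Qed.

(** Doubling turns [theta_3 ^ 2 * theta_4 ^ 2] into a square. *)
Lemma theta4_sqr_ge0 tau : 0 < tau -> 0 <= theta4_sqr tau.
Proof.
move=> tau0; rewrite -(pmulr_rge0 _ (theta0_sqr_gt0 tau0)).
by rewrite -theta4_sqr_double // sqr_ge0.
Qed.

Lemma theta4_sqr_le tau : 0 < tau -> theta4_sqr tau <= theta 0 tau ^+ 2.
Proof.
by move=> tau0; rewrite (theta0_sqr tau0) /theta4_sqr lerBlDr -addrA lerDl addr_ge0 ?sqr_ge0.
Qed.

Lemma theta_half_sqr_le tau : 0 < tau -> theta (1 / 2) tau ^+ 2 <= theta 0 tau ^+ 2.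
Proof.
move=> tau0; rewrite theta_half_sqr // (theta0_sqr tau0) -subr_ge0.
rewrite (_ : _ - _ = (theta 0 (2 * tau) - theta (1 / 2) (2 * tau)) ^+ 2) ?sqr_ge0 //.
by ring.
Qed.

Lemma agm_double : agm_iteration (fun j => theta 0 (2 ^+ j) ^+ 2 : R)
                                 (fun j => theta4_sqr (2 ^+ j)).
Proof.
split=> j; have j0 : 0 < 2 ^+ j :> R by rewrite exprn_gt0.
- exact: sqr_ge0.
- exact: theta4_sqr_ge0.
- by rewrite [2 ^+ j.+1]exprS (theta0_sqr j0) /theta4_sqr; field.
- by rewrite [2 ^+ j.+1]exprS theta4_sqr_double.
Qed.

Lemma agm_halve :
  agm_iteration (fun j => (1 / 2) ^+ j * theta 0 ((1 / 2) ^+ j) ^+ 2 : R)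
                (fun j => (1 / 2) ^+ j * theta (1 / 2) ((1 / 2) ^+ j) ^+ 2).
Proof.
have t0 j : 0 < (1 / 2) ^+ j :> R by rewrite exprn_gt0.
have t2 j : 2 * (1 / 2) ^+ j.+1 = (1 / 2) ^+ j :> R by rewrite exprS; lra.
split=> j.
- by rewrite mulr_ge0 ?sqr_ge0 ?(ltW (t0 _)).
- by rewrite mulr_ge0 ?sqr_ge0 ?(ltW (t0 _)).
- by rewrite theta0_sqr // t2 [(1 / 2) ^+ j.+1]exprS; field.
- by rewrite exprMn theta_half_pow4 // t2 [(1 / 2) ^+ j.+1]exprS; field.
Qed.

Lemma geometric_squeeze (f : nat -> R) (r : R) : 0 < r < 1 ->
  (forall j, (1 - r ^+ j) ^+ 2 <= f j <= (1 + r ^+ j) ^+ 2) ->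
  f j @[j --> \oo] --> (1 : R).
Proof.
move=> /andP[r0 r1] fr.
have rj : r ^+ j @[j --> \oo] --> (0 : R) by apply: cvg_expr; rewrite gtr0_norm.
have sqr1 (g : nat -> R) : g j @[j --> \oo] --> (1 : R) ->
    g j ^+ 2 @[j --> \oo] --> (1 : R).
  by move=> g1; rewrite -[X in _ --> X]mulr1; apply: cvgM.
apply: (squeeze_cvgr (nearW _ fr)); apply: sqr1.
  by rewrite -[X in _ --> X]subr0; apply: cvgB => //; exact: cvg_cst.
by rewrite -[X in _ --> X]addr0; apply: cvgD => //; exact: cvg_cst.
Qed.

(** Both AGM iterations tend to 1, at the rate [r ^ j] with
    [r = sqrt (1 / 2)]. *)
Lemma theta_self_dual_point : theta4_sqr 1 = theta (1 / 2) 1 ^+ 2 :> R.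
Proof.
pose r : R := Num.sqrt (1 / 2).
have half0 : 0 < 1 / 2 :> R by lra.
have rr : r ^+ 2 = 1 / 2 by rewrite sqr_sqrtr // ltW.
have r0 : 0 < r by rewrite sqrtr_gt0.
have r1 : r < 1 by rewrite -(@ltr_pXn2r _ 2) ?nnegrE ?ltW // rr; lra.
have rj0 j : 0 < r ^+ j by rewrite exprn_gt0.
have rj1 j : r ^+ j <= 1 by rewrite exprn_ile1 ?ltW.
have r01 : 0 < r < 1 by rewrite r0.
have halve : (1 / 2) ^+ j * theta 0 ((1 / 2) ^+ j) ^+ 2 @[j --> \oo] --> (1 : R).
  apply: (geometric_squeeze r01) => j; have t0 : 0 < (1 / 2) ^+ j :> R by rewrite exprn_gt0.
  have := theta0_bounds t0; rewrite -rr exprAC sqrtr_sqr.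
  rewrite (ger0_norm (ltW (rj0 j))) => /andP[lo hi].
  by rewrite -exprMn !lerXn2r ?nnegrE ?subr_ge0 ?mulr_ge0 ?addr_ge0 ?theta_ge0 ?(ltW (rj0 j)).
have double : theta 0 (2 ^+ j) ^+ 2 @[j --> \oo] --> (1 : R).
  apply: (geometric_squeeze r01) => j; have t0 : 0 < 2 ^+ j :> R by rewrite exprn_gt0.
  have th1 := theta0_ge1 t0; have th0 := theta_ge0 0 (2 ^+ j : R).
  have /andP[_ hi] := theta0_bounds t0.
  have rj2 : r ^+ j * Num.sqrt (2 ^+ j) = 1.
    rewrite -[r ^+ j](ger0_norm (ltW (rj0 j))) -sqrtr_sqr -sqrtrM ?sqr_ge0 //.
    by rewrite exprAC rr -exprMn mul1r mulVf ?expr1n ?sqrtr1 // pnatr_eq0.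
  have th_le : theta 0 (2 ^+ j) <= 1 + r ^+ j.
    by have := ler_wpM2l (ltW (rj0 j)) hi; rewrite mulrA mulrDr rj2 mul1r mulr1 addrC.
  rewrite !lerXn2r ?nnegrE ?subr_ge0 ?addr_ge0 ?(ltW (rj0 j)) //.
  by rewrite (le_trans _ th1) // gerBl (ltW (rj0 j)).
have := agm_inj agm_double agm_halve _ _ _ _ ltr01 double halve.
rewrite !expr0 ![1 * _ ^+ 2]mul1r; apply=> //.
- exact: theta0_sqr_gt0.
- exact: theta4_sqr_le.
- exact: theta_half_sqr_le.
Qed.

End SelfDualPoint.

(** * Theta series of integer and Construction A lattices *)

Section LatticeTheta.
Local Open Scope classical_set_scope.
Variable R : realType.

Lemma expR_sqnorm n (l : 'rV[R]_n) (x : R) :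
  expR (- (x * sqnorm l)) = \prod_i expR (- (x * l 0 i ^+ 2)).
Proof.
rewrite /sqnorm mulr_sumr -sumrN.
exact: (big_morph _ (@expRD R) (@expR0 R)).
Qed.

Lemma theta_series_integer_lattice n (tau : R) : 0 < tau ->
  theta_series (integer_lattice R n) tau = theta3 tau ^+ n.
Proof.
move=> tau0; rewrite theta3E /theta_series /integer_lattice esum_image; last first.
  move=> z z' _ _ /rowP zz'; apply/rowP => i; have := zz' i.
  by rewrite !mxE; apply: intr_inj.
have := has_sum_row (n := n) (fun _ => theta_term_ge0 0 tau) (fun _ => theta_sum 0 tau0).
rewrite prodr_const card_ord /has_sum => sumE.
rewrite (_ : esum _ _ = (theta 0 tau ^+ n)%:E) // -sumE.
apply: eq_esum => z _; rewrite expR_sqnorm; congr EFin; apply: eq_bigr => i _.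
by rewrite /theta_term mxE addr0.
Qed.

Let point n (p : 'rV['F_2]_n * 'rV[int]_n) : 'rV[R]_n :=
  (Num.sqrt 2)^-1 *: map_mx intr (lift01 p.1 + 2 *: p.2).

(** The codeword is recovered by reduction modulo 2. *)
Lemma point_inj n : injective (@point n).
Proof.
move=> [c z] [c' z'] /rowP eq_p.
have eq_i i : ((c 0 i : nat)%:Z + 2 * z 0 i = (c' 0 i : nat)%:Z + 2 * z' 0 i)%R.
  have := eq_p i; rewrite /point !mxE => /mulfI H; apply: (@intr_inj R); apply: H.
  by rewrite invr_eq0 sqrtr_eq0 -ltNge ltr0n.
have lt2 (x : 'F_2) : (x < 2)%N := ltn_ord x.
congr (_, _); apply/rowP => i; have := eq_i i.
  by move=> ?; apply/val_inj => /=; have := lt2 (c 0 i); have := lt2 (c' 0 i); lia.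
by have := lt2 (c 0 i); have := lt2 (c' 0 i); lia.
Qed.

Lemma construction_AE n (C : {set 'rV['F_2]_n}) :
  construction_A R C = @point n @` ([set` C] `*`` fun=> [set: 'rV[int]_n]).
Proof.
apply/seteqP; split => [l [c Cc [z ->]]|l [[c z] /= [Cc _] <-]].
  by exists (c, z).
by exists c => //; exists z.
Qed.

Lemma esum_finset (T : finType) (C : {set T}) (f : T -> R) :
  (forall t, 0 <= f t) ->
  \esum_(t in [set` C]) (f t)%:E = (\sum_(t in C) f t)%:E.
Proof.
move=> f0; rewrite (_ : [set` C] = [set` enum C]); last first.
  by apply/seteqP; split => t /=; rewrite mem_enum.
rewrite esum_fset //; last by move=> t _; rewrite lee_fin.
by rewrite -fsbig_seq ?enum_uniq // big_enum /= sumEFin.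
Qed.

(** A coordinate [(c + 2 z) / sqrt 2] has square [2 (z + c / 2) ^ 2], so each
    coordinate contributes the term of a theta constant at [2 * tau], with shift
    0 or 1/2 according to the bit [c]. *)
Lemma theta_series_construction_A n (C : {set 'rV['F_2]_n}) (tau : R) : 0 < tau ->
  theta_series (construction_A R C) tau =
  \sum_(c in C) \prod_i
    (if c 0 i == 0 then theta 0 (2 * tau) else theta (1 / 2) (2 * tau)).
Proof.
move=> tau0; have tau20 : 0 < 2 * tau by rewrite mulr_gt0.
rewrite /theta_series construction_AE esum_image; last first.
  by move=> p q _ _; apply: point_inj.
pose w c z := (expR (- (pi * tau * sqnorm (point (c, z : 'rV[int]_n)))))%:E.
have -> : \esum_(p in [set` C] `*`` fun=> [set: 'rV[int]_n])
    (expR (- (pi * tau * sqnorm (point p))))%:E =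
    \esum_(c in [set` C]) \esum_(z in [set: 'rV[int]_n]) w c z.
  rewrite esum_esum; last by move=> *; rewrite lee_fin expR_ge0.
  by apply: eq_esum => -[].
pose F c := \prod_i theta (if (c : 'rV['F_2]_n) 0 i == 0 then 0 else 1 / 2) (2 * tau).
rewrite (_ : esum _ _ = (\sum_(c in C) F c)%:E) /=.
  by apply: eq_bigr => c _; apply: eq_bigr => i _; case: ifP.
rewrite -esum_finset; last by move=> c; rewrite prodr_ge0 // => i _; exact: theta_ge0.
apply: eq_esum => c _.
rewrite -(has_sum_row (fun i => theta_term_ge0 _ (2 * tau)) (fun i => theta_sum _ tau20)).
apply: eq_esum => z _; rewrite /w expR_sqnorm; congr EFin; apply: eq_bigr => i _.
rewrite /theta_term /point !mxE /= exprMn exprVn sqr_sqrtr ?ler0n //.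
congr expR; rewrite intrD intrM.
have two : 2%:~R = 2 :> R by [].
have lift0 : (nat_of_ord (0 : 'F_2))%:~R = 0 :> R by [].
have lift1 : (nat_of_ord (1 : 'F_2))%:~R = 1 :> R by [].
by case: (F2_cases (c 0 i)) => ->; rewrite two ?lift0 ?lift1 ?eqxx ?oner_eq0; field.
Qed.

End LatticeTheta.

(** * Expectation of a function of a uniform random element *)

Section UniformExpectation.
Variables (R : realType) (d : measure_display) (T : measurableType d).
Variables (P : probability T R) (F : finType) (X : T -> F) (A : {set F}).
Hypothesis X_unif : uniformly_distributed P X A.

Lemma expectation_uniform (f : F -> R) : (forall x, 0 <= f x) ->
  ('E_P[fun w => f (X w)] = ((\sum_(x in A) f x) / #|A|%:R)%:E)%E.
Proof.
move=> f0; have [mX PX] := X_unif; pose B x := (X @^-1` [set x])%classic.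
have m1 x : measurable_fun [set: T]%classic (fun w => (\1_(B x) w)%:E : \bar R).
  by apply/measurable_EFinP/measurable_indic; exact: mX.
rewrite unlock.
transitivity (\int[P]_w (\sum_(x : F) (f x)%:E * (\1_(B x) w)%:E))%E.
  apply: eq_integral => w _; rewrite (bigD1 (X w)) //= big1 => [|x xX].
    by rewrite indicE mem_set // mule1 adde0.
  by rewrite indicE memNset ?mule0 // => /esym/eqP; rewrite (negPf xX).
rewrite ge0_integral_sum //; last 2 first.
- by move=> x; apply: emeasurable_funM => //; exact: measurable_cst.
- by move=> x w _; rewrite -EFinM lee_fin mulr_ge0 // indicE ler0n.
transitivity (\sum_(x : F) (f x * ((x \in A)%:R / #|A|%:R))%:E)%E.
  apply: eq_bigr => x _; rewrite ge0_integralZl_EFin //.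
  rewrite integral_indic //; last exact: mX.
  by rewrite classical_sets.setIT EFinM -PX.
rewrite sumEFin; congr EFin; rewrite mulr_suml [RHS]big_mkcond; apply: eq_bigr => x _.
by case: ifP => _; rewrite ?mul0r ?mulr0 ?mul1r.
Qed.

(** The point masses of the law add up to [#|A| / #|A|], which is 0 when [A] is
    empty. *)
Lemma uniform_support_neq0 : #|A| != 0%N.
Proof.
have := @expectation_uniform (fun=> 1) (fun=> ler01).
rewrite (expectation_cst P 1) => -[]; rewrite sumr_const => E1.
by apply/eqP => A0; move/eqP: E1; rewrite A0 mul0r oner_eq0.
Qed.

End UniformExpectation.

(** * The mean theta series of a random self-dual code *)

Section ExpectedTheta.
Variables (R : realType) (n : nat).
Hypotheses (n_ge4 : (4 <= n)%N) (n_even : ~~ odd n).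
Let k := n./2.
Local Notation A := (self_dual_codes n).

Let n2k : n = k.*2. Proof. by rewrite even_halfK. Qed.
Let k_gt1 : (1 < k)%N. Proof. by have := n_ge4; rewrite n2k; lia. Qed.

Definition mean_theta (tau : R) : R :=
  (sympow k (theta 0 tau ^+ 2) (theta4_sqr tau) +
   sympow k (theta 0 tau ^+ 2) (theta (1 / 2) tau ^+ 2)) / (2 * (1 + 2 ^+ k.-1)).

(** The even vectors contribute powers of [x + y] and [x - y], whose squares are
    [p + e] and [p - e] for [p = theta_3 ^ 2] and [e = theta_2 ^ 2]; the vector 0
    and the all-one vector contribute powers of [x] and [y], whose squares are
    half of [p + d] and [p - d] for [d = theta_4 ^ 2]. *)
Lemma average_theta_series tau : 0 < tau -> #|A| != 0%N ->
  (\sum_(C in A) theta_series (construction_A R C) tau) / #|A|%:R =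
  mean_theta tau.
Proof.
move=> tau0 A0; set x := theta 0 (2 * tau); set y := theta (1 / 2) (2 * tau).
rewrite (eq_bigr _ (fun C _ => theta_series_construction_A C tau0)) -/x -/y.
have := average_self_dual (fun c => \prod_i (if c 0 i == 0 then x else y)) n2k k_gt1.
set total := \sum_(C in A) _; rewrite sum_even_prod.
have -> : \prod_(i < n) (if (0 : 'rV['F_2]_n) 0 i == 0 then x else y) = x ^+ n.
  by rewrite (eq_bigr (fun=> x)) ?prodr_const ?card_ord // => i _; rewrite mxE.
have -> : \prod_(i < n) (if (const_mx 1 : 'rV['F_2]_n) 0 i == 0 then x else y) = y ^+ n.
  by rewrite (eq_bigr (fun=> y)) ?prodr_const ?card_ord // => i _; rewrite mxE.
have expn z : z ^+ n = (z ^+ 2) ^+ k :> R by rewrite n2k -exprM mul2n.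
have pd : theta 0 tau ^+ 2 + theta4_sqr tau = 2 * x ^+ 2.
  by rewrite (theta0_sqr tau0) /theta4_sqr -/x -/y; ring.
have pd' : theta 0 tau ^+ 2 - theta4_sqr tau = 2 * y ^+ 2.
  by rewrite (theta0_sqr tau0) /theta4_sqr -/x -/y; ring.
have pe : theta 0 tau ^+ 2 + theta (1 / 2) tau ^+ 2 = (x + y) ^+ 2.
  by rewrite (theta0_sqr tau0) (theta_half_sqr tau0) -/x -/y; ring.
have pe' : theta 0 tau ^+ 2 - theta (1 / 2) tau ^+ 2 = (x - y) ^+ 2.
  by rewrite (theta0_sqr tau0) (theta_half_sqr tau0) -/x -/y; ring.
rewrite /mean_theta /sympow pd pd' pe pe' !expn !(exprMn _ 2).
have -> : 2 ^+ k = 2 * 2 ^+ k.-1 :> R by rewrite -exprS (ltn_predK k_gt1).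
have y0 : 0 < 2 ^+ k.-1 :> R by rewrite exprn_gt0.
set u := 2 ^+ k.-1 in y0 *; set N := #|A|%:R => E.
have N0 : N != 0 by rewrite pnatr_eq0.
have u0 : 1 + u != 0 by rewrite gt_eqF ?addr_gt0.
apply: (mulIf N0); rewrite mulfVK //; apply: (mulfI u0).
rewrite [1 + u]addrC {}E; field.
by rewrite [u + 1]addrC u0.
Qed.

Lemma theta3_expn tau : theta3 tau ^+ n = (theta 0 tau ^+ 2) ^+ k :> R.
Proof. by rewrite theta3E n2k -exprM mul2n. Qed.

Definition mean_ratio_min : R :=
  ((Num.sqrt 2 - 1) ^+ k + (Num.sqrt 2 + 1) ^+ k)
  / (2 `^ (k%:R / 2) * (1 + 2 ^+ k.-1)).

(** Two arguments with equal squares adding up to [p ^ 2] are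
    [p / sqrt 2] up to sign, the case of equality in Jensen's inequality. *)
Lemma sympow_diag (p : R) :
  sympow k p (p / Num.sqrt 2) = mean_ratio_min * (1 + 2 ^+ k.-1) * p ^+ k.
Proof.
have s0 : Num.sqrt 2 != 0 :> R by rewrite gt_eqF // sqrtr_gt0.
have u0 : 1 + 2 ^+ k.-1 != 0 :> R by rewrite gt_eqF ?addr_gt0 ?exprn_gt0.
have powE : 2 `^ (k%:R / 2) = Num.sqrt 2 ^+ k :> R.
  by rewrite mulrC powRrM powR_mulrn ?powR_ge0 // powR12_sqrt.
rewrite /sympow /mean_ratio_min powE.
have -> : p + p / Num.sqrt 2 = (Num.sqrt 2 + 1) / Num.sqrt 2 * p by field.
have -> : p - p / Num.sqrt 2 = (Num.sqrt 2 - 1) / Num.sqrt 2 * p by field.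
rewrite !exprMn !exprVn; field.
by rewrite u0 expf_neq0.
Qed.

Lemma mean_theta_ge tau : 0 < tau -> mean_ratio_min * theta3 tau ^+ n <= mean_theta tau.
Proof.
move=> tau0; have p0 := ltW (theta0_sqr_gt0 tau0).
have u0 : 0 < 1 + 2 ^+ k.-1 :> R by rewrite addr_gt0 ?exprn_gt0.
rewrite /mean_theta ler_pdivlMr ?mulr_gt0 // theta3_expn.
apply: le_trans (sympow_ge_diag k (z := theta 0 tau ^+ 2 / Num.sqrt 2) p0 _).
  by rewrite sympow_diag mulr2n; rewrite le_eqVlt; apply/orP; left; apply/eqP; ring.
by rewrite jacobi_identity // expr_div_n sqr_sqrtr // mulr2n; field.
Qed.

Lemma mean_theta_le tau : 0 < tau -> mean_theta tau <= theta3 tau ^+ n.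
Proof.
move=> tau0; have p0 := ltW (theta0_sqr_gt0 tau0).
have u0 : 0 < 1 + 2 ^+ k.-1 :> R by rewrite addr_gt0 ?exprn_gt0.
rewrite /mean_theta ler_pdivrMr ?mulr_gt0 // theta3_expn.
apply: le_trans (sympow_le_ends k p0 (jacobi_identity tau0)) _.
set p := theta 0 tau ^+ 2.
have -> : sympow k p p = 2 * 2 ^+ k.-1 * p ^+ k.
  rewrite /sympow subrr expr0n gtn_eqF ?(ltn_trans _ k_gt1) // addr0.
  by rewrite -[p + p]mulr2n -(mulr_natl p 2) exprMn -exprS (ltn_predK k_gt1).
by rewrite /sympow subr0 addr0 le_eqVlt; apply/orP; left; apply/eqP; ring.
Qed.

(** At [tau = 1] the two arguments [theta_4 ^ 2] and [theta_2 ^ 2] agree, so the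
    lower bound is attained. *)
Lemma mean_theta1 : mean_theta 1 = mean_ratio_min * theta3 1 ^+ n.
Proof.
have p0 := theta0_sqr_gt0 (@ltr01 R).
have eqz : theta (1 / 2) 1 ^+ 2 = theta 0 1 ^+ 2 / Num.sqrt 2 :> R.
  apply/eqP; rewrite -(@eqrXn2 _ 2) ?sqr_ge0 ?divr_ge0 ?sqrtr_ge0 ?sqr_ge0 //.
  have := jacobi_identity (@ltr01 R); rewrite theta_self_dual_point => jac.
  by rewrite expr_div_n sqr_sqrtr // -jac; apply/eqP; field.
rewrite /mean_theta theta_self_dual_point eqz sympow_diag theta3_expn.
have u0 : 1 + 2 ^+ k.-1 != 0 :> R by rewrite gt_eqF ?addr_gt0 ?exprn_gt0.
by field.
Qed.

End ExpectedTheta.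

Theorem theorem6 (R : realType) (d : measure_display) (T : measurableType d)
    (P : probability T R) (n : nat) (C : T -> {set 'rV['F_2]_n})
    (n_ge8 : (8 <= n)%N) (n_even : ~~ odd n)
    (C_unif : uniformly_distributed P C (self_dual_codes n)) :
  let k := n./2 in
  (forall tau : R, 0 < tau ->
     ('E_P[fun w => theta_ratio (construction_A R (C w)) 1] <=
      'E_P[fun w => theta_ratio (construction_A R (C w)) tau])%E) /\
  (forall tau : R, 0 < tau ->
     ((((Num.sqrt 2 - 1) ^+ k + (Num.sqrt 2 + 1) ^+ k)
        / (2 `^ (k%:R / 2) * (1 + 2 ^+ k.-1)) * theta3 tau ^+ n)%:E <=
        'E_P[fun w => theta_series (construction_A R (C w)) tau])%E /\
     ('E_P[fun w => theta_series (construction_A R (C w)) tau] <=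
        (theta3 tau ^+ n)%:E)%E).
Proof.
move=> k; have n_ge4 : (4 <= n)%N by apply: leq_trans n_ge8.
have A0 := uniform_support_neq0 C_unif.
have theta_pos tau : 0 < tau -> 0 < theta3 tau ^+ n :> R.
  by move=> tau0; rewrite theta3_expn // exprn_gt0 // theta0_sqr_gt0.
have series_ge0 L (tau : R) : 0 <= theta_series (L : set 'rV[R]_n) tau.
  by apply/fine_ge0/esum_ge0 => l _; rewrite lee_fin expR_ge0.
have mean tau : 0 < tau ->
    ('E_P[fun w => theta_series (construction_A R (C w)) tau] =
     (mean_theta n tau)%:E)%E.
  move=> tau0; rewrite (expectation_uniform C_unif
    (f := fun S => theta_series (construction_A R S) tau)) //.
  by rewrite average_theta_series.
have mean_ratio tau : 0 < tau ->
    ('E_P[fun w => theta_ratio (construction_A R (C w)) tau] =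
     (mean_theta n tau / theta3 tau ^+ n)%:E)%E.
  move=> tau0; rewrite (expectation_uniform C_unif
    (f := fun S => theta_ratio (construction_A R S) tau)); last first.
    by move=> S; rewrite divr_ge0.
  rewrite /theta_ratio theta_series_integer_lattice // -mulr_suml mulrAC.
  by rewrite average_theta_series.
split=> tau tau0; last first.
  by rewrite mean // !lee_fin mean_theta_ge ?mean_theta_le.
rewrite !mean_ratio // lee_fin mean_theta1 // mulfK ?gt_eqF ?theta_pos //.
by rewrite ler_pdivlMr ?theta_pos // mean_theta_ge.
Qed.
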